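(* Let $n,k$ be positive integers with $k>n$, and let $f\colon\mathbb{N}\to\mathbb{C}$ be a function such that the series $L(\mathbf{k},f,J)$ is absolutely convergent for every nonempty subset $J\subset\{1,\ldots,n\}$ and every $\mathbf{k}\in I(\max J)$. Then \[\sum_{\emptyset\ne J\subset\{1,\ldots,n\}}\ \sum_{\mathbf{k}\in I(\max J)}(-1)^{\lvert J\rvert-1}L(\mathbf{k},f,J)=\sum_{m=1}^\infty\frac{f(m)}{m^k}.\]
   Context: $\mathbb{N}=\{1,2,\ldots\}$. For fixed $n,k\in\mathbb{N}$ with $k>n$ and $r\in\{1,\ldots,n\}$, \[I(r)=\bigl\{\mathbf{k}=(k_1,\ldots,k_n)\in\mathbb{N}^n \bigm| k_n\geq 2,\ k_1+\cdots+k_n=k,\ k_1=\cdots=k_{r-1}=1\bigr\}.\] (For $r=1$ the last condition is empty.) For a function $f\colon\mathbb{N}\to\mathbb{C}$, a nonempty subset $J\subset\{1,\ldots,n\}$ and $\mathbf{k}=(k_1,\ldots,k_n)\in\mathbb{N}^n$, \[L(\mathbf{k},f,J)=\sum_{m_1,\ldots,m_n=1}^\infty\frac{f\bigl(\sum_{j\in J}m_j\bigr)}{m_1^{k_1}(m_1+m_2)^{k_2}\cdots(m_1+\cdots+m_n)^{k_n}}.\] *)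

(* Defs.v *)
From HB Require Import structures.
From mathcomp Require Import all_boot all_order all_algebra.
From mathcomp Require Import complex.
From mathcomp Require Import all_classical all_reals all_analysis.
From mathcomp.analysis.showcase Require summability.

Set Implicit Arguments.
Unset Strict Implicit.
Unset Printing Implicit Defensive.

Import Order.TTheory GRing.Theory Num.Theory.
Import numFieldNormedType.Exports.

Local Open Scope classical_set_scope.
Local Open Scope ring_scope.

(* The indices 1, ..., n are represented by the ordinals 0, ..., n-1. The
   entries of a member of I(r) are at most k because they sum to k, so taking
   values in 'I_k.+1 loses nothing and makes I(r) a finite set. *)
Definition Iset (n k r : nat) : {set {ffun 'I_n -> 'I_k.+1}} :=
  [set kk : {ffun 'I_n -> 'I_k.+1} |
    [&& [forall i : 'I_n, (1 <= kk i)%N],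
        [forall i : 'I_n, (i.+1 == n) ==> (2 <= kk i)%N],
        (\sum_(i < n) kk i == k)%N &
        [forall i : 'I_n, (i.+1 < r)%N ==> (kk i == 1 :> nat)]]]%SET.

Definition maxidx (n : nat) (J : {set 'I_n}) : nat := (\max_(j in J) j.+1)%N.

(* Here m : {ffun 'I_n -> nat} stands for the tuple of positive integers
   (m_1, ..., m_n) with m_{i+1} = (m i).+1. In particular f is only evaluated
   at positive integers when J is nonempty. *)
Definition Lterm (R : realType) (n : nat) (kk : 'I_n -> nat) (f : nat -> R[i])
    (J : {set 'I_n}) (m : {ffun 'I_n -> nat}) : R[i]^o :=
  f (\sum_(j in J) (m j).+1)%N /
  \prod_(i < n) (\sum_(j < n | (j <= i)%N) (m j).+1)%N%:R ^+ kk i.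

Definition L_abs_cvg (R : realType) (n : nat) (kk : 'I_n -> nat)
    (f : nat -> R[i]) (J : {set 'I_n}) : Prop :=
  summable [set: {ffun 'I_n -> nat}]
    (fun m => (ComplexField.Normc.normc (Lterm kk f J m))%:E).

(* The n-fold series is the limit of its finite partial sums along the net of
   finite subsets of the index set, which for an absolutely convergent series
   does not depend on any order of summation. *)
Definition L (R : realType) (n : nat) (kk : 'I_n -> nat) (f : nat -> R[i])
    (J : {set 'I_n}) : R[i]^o :=
  summability.sum (Lterm kk f J).

(* Main.v *)
Require Import Defs.
From HB Require Import structures.
From mathcomp Require Import finmap.
From mathcomp Require Import all_boot all_order all_algebra.
From mathcomp Require Import complex.
From mathcomp Require Import all_classical all_reals all_analysis.
From mathcomp.analysis.showcase Require summability.
From mathcomp Require Import ring lra zify.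

(* Write N_i = m_1 + ... + m_i. Truncate all the series L(k,f,J) to N_n < A and
   sum_{j in J} m_j <= c. For fixed M >= 1 and a, the signed sum over J, k and
   all m with sum_{j in J} m_j = M and N_n = a of the products of the N_i^{-k_i}
   is then a finite sum, and it has a closed form (Rsum_admissible1), found by
   induction on n (removal of the last coordinate): with the generating series
     sum_J (-1)^|J| sum_m q^(sum_J m) t^(N_n) / (N_1 ... N_n)
       = coefficient of y^n in ((1 - qt) / (1 - t))^y
   the sum equals V_n(M, a) / (a M^(k-n)), where V_n(M, a) is the coefficient of
   q^M t^a y^(n-1) in qt/(1 - qt) ((1 - qt)/(1 - t))^y. So the weight k enters
   only through a power of M. What remains is sum_a V_n(M, a) / a = M^{-n}, which
   is the Beta integral sum_j (y)_j / (j! (M + j)) = (M - 1)! / (1 - y)_M read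
   coefficientwise in y. Absolute convergence lets A tend to infinity before c. *)

Set Implicit Arguments.
Unset Strict Implicit.
Unset Printing Implicit Defensive.

Import Order.TTheory GRing.Theory Num.Theory.
Import numFieldNormedType.Exports.

Local Open Scope classical_set_scope.
Local Open Scope ring_scope.

(** * Rising factorials and the coefficients of ((1 - qt)/(1 - t))^y *)

Section Coefficients.
Variable K : numFieldType.
Implicit Types (y : {poly K}) (n M a j : nat).

(* y (y+1) ... (y+j-1) / j!, the coefficient of t^j in (1 - t)^(-y). *)
Definition mchoose y j : {poly K} := j`!%:R^-1 *: \prod_(i < j) (y + i%:R).

Lemma mchoose0 y : mchoose y 0 = 1.
Proof. by rewrite /mchoose big_ord0 fact0 invr1 scale1r. Qed.

Lemma mchooseS y j : j.+1%:R * mchoose y j.+1 = mchoose y j * (y + j%:R).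
Proof.
rewrite /mchoose big_ord_recr /= factS natrM invfM mulr_natl -scaler_nat scalerA mulrA.
by rewrite mulfV ?pnatr_eq0// mul1r -scalerAl.
Qed.

(** Coefficientwise form of t d/dt (1 - t)^(-y) = y t/(1 - t) (1 - t)^(-y), since multiplication by
    t/(1 - t) takes partial sums. *)
Lemma mchoose_sum y j : j%:R * mchoose y j = y * \sum_(i < j) mchoose y i.
Proof.
elim: j => [|j IHj]; first by rewrite big_ord0 mul0r mulr0.
by rewrite mchooseS big_ord_recr /= !mulrDr [_ * j%:R]mulrC IHj addrC [_ * y]mulrC.
Qed.

(* The coefficient of q^M t^a y^n in ((1 - qt)/(1 - t))^y. *)
Definition Ycoef n M a : K :=
  if (M <= a)%N then (mchoose (- 'X) M * mchoose 'X (a - M))`_n else 0.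

(* The coefficient of q^M t^a y^n in y qt/(1 - qt) ((1 - qt)/(1 - t))^y. *)
Definition Vcoef n M a : K :=
  if (M <= a)%N
  then ('X * (\sum_(i < M) mchoose (- 'X) i) * mchoose 'X (a - M))`_n else 0.

Lemma Vcoef0 M a : Vcoef 0 M a = 0.
Proof. by rewrite /Vcoef; case: ifP => // _; rewrite -mulrA coefXM. Qed.

Lemma mchooseX0 j : (mchoose 'X j)`_0 = (j == 0%N)%:R.
Proof.
case: j => [|j]; first by rewrite mchoose0 coef1.
by rewrite /mchoose coefZ big_ord_recl /= addr0 coefXM mulr0.
Qed.

Lemma mchooseNX0 j : (mchoose (- 'X) j)`_0 = (j == 0%N)%:R.
Proof.
case: j => [|j]; first by rewrite mchoose0 coef1.
by rewrite /mchoose coefZ big_ord_recl /= addr0 mulNr coefN coefXM oppr0 mulr0.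
Qed.

Lemma Ycoef0 M a : Ycoef 0 M a = ((M == 0) && (a == 0))%N%:R.
Proof.
rewrite /Ycoef; case: ifP => Ma.
  rewrite coef0M mchooseX0 mchooseNX0 -natrM mulnb; congr (nat_of_bool _)%:R; lia.
by have -> : ((M == 0) && (a == 0))%N = false by lia.
Qed.

Lemma coefXS (p : {poly K}) n : ('X * p)`_n.+1 = p`_n.
Proof. by rewrite coefXM. Qed.

Lemma sum_predn (F : nat -> K) k a : (k <= a)%N ->
  \sum_(x < a | (x < k)%N) F (k - x.+1)%N = \sum_(i < k) F i.
Proof.
move=> ka; rewrite (eq_bigr (fun x : 'I_a => (fun x => F (k - x.+1)%N) x))//.
rewrite -(big_ord_widen _ (fun x => F (k - x.+1)%N))//.
by rewrite [RHS](reindex_inj rev_ord_inj).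
Qed.

(** Apply t d/dt to ((1 - qt)/(1 - t))^y: its logarithmic derivative is y (t/(1 - t) - qt/(1 - qt)),
    whose two terms give the two sums. *)
Lemma YcoefS n M a : a%:R * Ycoef n.+1 M a =
  \sum_(x < a) Ycoef n M (a - x.+1) -
  \sum_(x < a | (x < M)%N) Ycoef n (M - x.+1) (a - x.+1).
Proof.
rewrite {1}/Ycoef; case: ifPn => [Ma|]; last first.
  rewrite -ltnNge => aM; rewrite mulr0 !big1 ?subr0// => x.
    by move=> xM; rewrite /Ycoef ifF//; have := ltn_ord x; lia.
  by move=> _; rewrite /Ycoef ifF//; have := ltn_ord x; lia.
have -> : \sum_(x < a) Ycoef n M (a - x.+1) =
    (mchoose (- 'X) M * \sum_(i < a - M) mchoose 'X i)`_n.
  rewrite (bigID (fun x : 'I_a => (x < a - M)%N)) /= [X in _ + X]big1 ?addr0.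
    rewrite mulr_sumr coef_sum -(sum_predn
      (fun i => (mchoose (- 'X) M * mchoose 'X i)`_n) (leq_subr M a)).
    apply: eq_bigr => x xa; rewrite /Ycoef ifT; last by have := ltn_ord x; lia.
    by congr (_ * mchoose _ _)`_n; have := ltn_ord x; lia.
  by move=> x xa; rewrite /Ycoef ifF//; have := ltn_ord x; lia.
have -> : \sum_(x < a | (x < M)%N) Ycoef n (M - x.+1) (a - x.+1) =
    ((\sum_(i < M) mchoose (- 'X) i) * mchoose 'X (a - M))`_n.
  rewrite mulr_suml coef_sum.
  rewrite -(sum_predn (fun i => (mchoose (- 'X) i * mchoose 'X (a - M))`_n) Ma).
  apply: eq_bigr => x xM; rewrite /Ycoef ifT; last by have := ltn_ord x; lia.
  by congr (_ * mchoose _ _)`_n; have := ltn_ord x; lia.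
(* The exponent of t is a - M in (1 - t)^(-y) and M in (1 - qt)^y, so [mchoose_sum] applies to each
   factor separately. *)
have -> : a%:R = (a - M)%N%:R + M%:R :> K by rewrite -natrD subnK.
rewrite -coefB -[RHS]coefXS.
rewrite mulrDl !mulr_natl -!coefMn -coefD; apply: (congr1 (coefp n.+1)).
rewrite -[X in X + _]mulr_natl -[X in _ + X]mulr_natl.
have := mchoose_sum (- 'X) M; have := mchoose_sum 'X (a - M).
set A := _%:R; set B := M%:R => h1 h2; rewrite mulrBr.
rewrite [A * _]mulrCA h1 [B * _]mulrA h2; ring.
Qed.

(** Multiplication by qt/(1 - qt) sums over steps that lower the exponents of q and t together; the
    prefactor y lowers n by one. *)
Lemma VcoefS n M a : Vcoef n.+1 M a =
  \sum_(x < a | (x < M)%N) Ycoef n (M - x.+1) (a - x.+1).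
Proof.
rewrite /Vcoef; case: ifPn => [Ma|]; last first.
  rewrite -ltnNge => aM; rewrite big1// => x xM.
  by rewrite /Ycoef ifF//; have := ltn_ord x; lia.
rewrite -mulrA coefXS mulr_suml coef_sum.
rewrite -(sum_predn (fun i => (mchoose (- 'X) i * mchoose 'X (a - M))`_n) Ma).
apply: eq_bigr => x xM; rewrite /Ycoef ifT; last by have := ltn_ord x; lia.
by congr (_ * mchoose _ _)`_n; have := ltn_ord x; lia.
Qed.

(** The operator t d/dt - q d/dq kills every function of qt and multiplies (1 - t)^(-y) by y t/(1 -
    t). *)
Lemma VcoefS_sum n M a :
  (a%:R - M%:R) * Vcoef n.+1 M a = \sum_(x < a) Vcoef n M (a - x.+1).
Proof.
rewrite {1}/Vcoef; case: ifPn => [Ma|]; last first.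
  rewrite -ltnNge => aM; rewrite mulr0 big1// => x _.
  by rewrite /Vcoef ifF//; have := ltn_ord x; lia.
rewrite (bigID (fun x : 'I_a => (x < a - M)%N)) /= [X in _ = _ + X]big1 ?addr0; last first.
  by move=> x xa; rewrite /Vcoef ifF//; have := ltn_ord x; lia.
set E := 'X * _.
transitivity ((E * \sum_(i < a - M) mchoose 'X i)`_n); last first.
  rewrite mulr_sumr coef_sum.
  rewrite -(sum_predn (fun i => (E * mchoose 'X i)`_n) (leq_subr M a)).
  apply: eq_bigr => x xa; rewrite /Vcoef ifT; last by have := ltn_ord x; lia.
  by congr (_ * mchoose _ _)`_n; have := ltn_ord x; lia.
rewrite -natrB// -[RHS]coefXS mulr_natl -coefMn -mulr_natl.
apply: (congr1 (coefp n.+1)).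
by rewrite mulrCA mchoose_sum mulrCA.
Qed.

End Coefficients.

(** * Splitting off the last coordinate of a tuple *)

Lemma forall_ord_recr n (P : pred 'I_n.+1) :
  [forall i, P i] = P ord_max && [forall i : 'I_n, P (widen_ord (leqnSn n) i)].
Proof.
have E m (Q : pred 'I_m) : [forall i, Q i] = \big[andb/true]_i Q i.
  by rewrite big_andE; apply: eq_forallb.
by rewrite !E big_ord_recr /= andbC.
Qed.

Lemma exists_ord_recr n (P : pred 'I_n.+1) :
  [exists i, P i] = P ord_max || [exists i : 'I_n, P (widen_ord (leqnSn n) i)].
Proof.
have E m (Q : pred 'I_m) : [exists i, Q i] = \big[orb/false]_i Q i.
  by rewrite big_orE; apply: eq_existsb.
by rewrite !E big_ord_recr /= orbC.
Qed.

Section Snoc.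
Variables (T : finType).

Definition snoc n (z : {ffun 'I_n -> T}) (t : T) : {ffun 'I_n.+1 -> T} :=
  [ffun i => if unlift ord_max i is Some j then z j else t].

Lemma snoc_max n (z : {ffun 'I_n -> T}) t : snoc z t ord_max = t.
Proof. by rewrite ffunE unlift_none. Qed.

Lemma snoc_widen n (z : {ffun 'I_n -> T}) t i :
  snoc z t (widen_ord (leqnSn n) i) = z i.
Proof.
have -> : widen_ord (leqnSn n) i = lift ord_max i.
  by apply: ord_inj; rewrite lift_max.
by rewrite ffunE liftK.
Qed.

Lemma sum_snoc (V : nmodType) n (G : {ffun 'I_n.+1 -> T} -> V) :
  \sum_z G z = \sum_t \sum_z G (snoc z t).
Proof.
rewrite pair_bigA /=.
apply: (reindex (fun p : T * {ffun 'I_n -> T} => snoc p.2 p.1)).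
apply: onW_bij; exists (fun z : {ffun 'I_n.+1 -> T} =>
  (z ord_max, [ffun i : 'I_n => z (widen_ord (leqnSn n) i)])).
  move=> [t z] /=; rewrite snoc_max; congr pair.
  by apply/ffunP => i; rewrite ffunE snoc_widen.
move=> z; apply/ffunP => i; rewrite ffunE /=; case: unliftP => [j|] ->//.
by rewrite ffunE; congr (z _); apply: ord_inj; rewrite lift_max.
Qed.

End Snoc.

(** * Signed sums over words: recurrences and closed forms *)

Section Words.
Variables (F : numFieldType) (K A : nat).
Notation T := (bool * 'I_K * 'I_A)%type.
Implicit Types (n l s M a x : nat).

Lemma sum_triple (V : nmodType) (H : T -> V) :
  \sum_t H t = \sum_b \sum_k \sum_x H (b, k, x).
Proof. by rewrite !pair_bigA; apply: eq_bigr => -[[]]. Qed.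

(* A word of length n encodes J, k and m: its i-th letter is
   (i \in J, k_i, m_i - 1). *)
Definition bit (t : T) : bool := t.1.1.
Definition expo (t : T) : nat := t.1.2.
Definition step (t : T) : nat := t.2.+1.

Section Statistics.
Variables (n : nat) (z : {ffun 'I_n -> T}).
Definition partial_step (i : 'I_n) := (\sum_(j < n | (j <= i)%N) step (z j))%N.
Definition total_step := (\sum_(j < n) step (z j))%N.
Definition marked_step := (\sum_(j < n | bit (z j)) step (z j))%N.
Definition total_expo := (\sum_(j < n) expo (z j))%N.
Definition parity : F := (-1) ^+ (\sum_(j < n) bit (z j))%N.
Definition weight : F := \prod_(i < n) (partial_step i)%:R ^- expo (z i).
Definition all_ones := [forall i, expo (z i) == 1%N].
(* The [s]-bound on the last exponent gives k_n >= 2 for s = 1 and nothing for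
   s = 0; the last conjunct is the condition k_i = 1 for i < max J. *)
Definition admissible s :=
  [&& [exists i, bit (z i)], [forall i, (0 < expo (z i))%N],
      [forall i : 'I_n, (i.+1 == n) ==> (s < expo (z i))%N] &
      [forall i : 'I_n, [exists j : 'I_n, (i < j)%N && bit (z j)] ==>
                        (expo (z i) == 1%N)]].
End Statistics.

Section SnocStatistics.
Variables (n : nat) (z : {ffun 'I_n -> T}) (t : T).

Lemma total_step_snoc : total_step (snoc z t) = (total_step z + step t)%N.
Proof.
rewrite /total_step big_ord_recr /= snoc_max; congr addn.
by apply: eq_bigr => i _; rewrite snoc_widen.
Qed.

Lemma total_expo_snoc : total_expo (snoc z t) = (total_expo z + expo t)%N.
Proof.
rewrite /total_expo big_ord_recr /= snoc_max; congr addn.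
by apply: eq_bigr => i _; rewrite snoc_widen.
Qed.

Lemma marked_step_snoc :
  marked_step (snoc z t) = (marked_step z + bit t * step t)%N.
Proof.
rewrite /marked_step big_mkcond [in RHS]big_mkcond big_ord_recr /= snoc_max.
congr addn; last by case: (bit t); rewrite ?mul1n ?mul0n.
by apply: eq_bigr => i _; rewrite snoc_widen.
Qed.

Lemma parity_snoc : parity (snoc z t) = (-1) ^+ bit t * parity z.
Proof.
rewrite /parity big_ord_recr /= snoc_max exprD mulrC; congr (_ * _ ^+ _).
by apply: eq_bigr => i _; rewrite snoc_widen.
Qed.

Lemma weight_snoc :
  weight (snoc z t) = weight z * (total_step z + step t)%N%:R ^- expo t.
Proof.
rewrite /weight big_ord_recr /= snoc_max; congr (_ * _%:R ^- _); last first.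
  rewrite -total_step_snoc /partial_step /total_step.
  by apply: eq_bigl => j; rewrite /= -ltnS ltn_ord.
apply: eq_bigr => i _; rewrite snoc_widen; congr (_%:R ^- _).
rewrite /partial_step big_mkcond big_ord_recr /= leqNgt ltn_ord addn0.
rewrite [RHS]big_mkcond; apply: eq_bigr => j _.
by rewrite snoc_widen.
Qed.

Lemma all_ones_snoc : all_ones (snoc z t) = (expo t == 1%N) && all_ones z.
Proof.
rewrite /all_ones forall_ord_recr snoc_max; congr andb.
by apply: eq_forallb => i; rewrite snoc_widen.
Qed.

(** If the last letter lies in J, its position is max J and all earlier exponents must be 1.
    Otherwise J lives on the shorter word, whose last exponent need only be positive, whence the
    0. *)
Lemma admissible_snoc s : admissible (snoc z t) s =
  (s < expo t)%N && (if bit t then all_ones z else admissible z 0).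
Proof.
rewrite /admissible exists_ord_recr !forall_ord_recr snoc_max eqxx /=.
have -> : [exists i : 'I_n, bit (snoc z t (widen_ord (leqnSn n) i))] =
          [exists i : 'I_n, bit (z i)].
  by apply: eq_existsb => i; rewrite snoc_widen.
have -> : [forall i : 'I_n, (0 < expo (snoc z t (widen_ord (leqnSn n) i)))%N] =
          [forall i : 'I_n, (0 < expo (z i))%N].
  by apply: eq_forallb => i; rewrite snoc_widen.
have -> : [forall i : 'I_n, (i.+1 == n.+1) ==>
            (s < expo (snoc z t (widen_ord (leqnSn n) i)))%N] = true.
  by apply/forallP => i; rewrite eqSS ltn_eqF.
have -> : [exists j : 'I_n.+1, (n < j)%N && bit (snoc z t j)] = false.
  by apply/existsP => -[j /andP[]]; rewrite ltnNge -ltnS ltn_ord.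
have -> : [forall i : 'I_n,
    [exists j : 'I_n.+1, (i < j)%N && bit (snoc z t j)] ==>
    (expo (snoc z t (widen_ord (leqnSn n) i)) == 1%N)] =
  [forall i : 'I_n, bit t || [exists j : 'I_n, (i < j)%N && bit (z j)] ==>
    (expo (z i) == 1%N)].
  apply: eq_forallb => i; rewrite snoc_widen exists_ord_recr /= ltn_ord snoc_max.
  by congr (_ || _ ==> _); apply: eq_existsb => j; rewrite snoc_widen.
have last0 : [forall i, (0 < expo (z i))%N] ->
    [forall i : 'I_n, (i.+1 == n) ==> (0 < expo (z i))%N].
  by move=> /forallP z0; apply/forallP => i; rewrite z0 implybT.
rewrite andbT; case: (ltnP s (expo t)) => [st|_]; last by rewrite !andbF.
have -> /= : (0 < expo t)%N by exact: leq_ltn_trans st.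
case: (bit t) => /=; last first.
  by case: [exists _, _] => //=; case: (boolP [forall _, _]) => //= /last0 ->.
rewrite /all_ones; apply/andP/idP => [[_ /forallP h]|/forallP h].
  by apply/forallP => i; exact: h.
by split; apply/forallP => i; rewrite (eqP (h i)).
Qed.

End SnocStatistics.

Lemma admissible_total_expo n (z : {ffun 'I_n -> T}) s :
  admissible z s -> (n <= total_expo z)%N.
Proof.
move=> /and4P[_ /forallP z0 _ _]; rewrite -[X in (X <= _)%N]card_ord -sum1_card.
exact: leq_sum.
Qed.

Lemma all_ones_total_expo n (z : {ffun 'I_n -> T}) :
  all_ones z -> total_expo z = n.
Proof.
move=> /forallP z1; rewrite -[RHS]card_ord -sum1_card.
by apply: eq_bigr => i _; apply/eqP.
Qed.

(** The coefficient of q^M t^a in the generating polynomial of G over Q, where q marks the sum over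
    J and t marks N_n. *)
Definition slice n (Q : pred {ffun 'I_n -> T}) (G : {ffun 'I_n -> T} -> F) M a :=
  \sum_(z | [&& Q z, total_step z == a & marked_step z == M]) G z.

Lemma slice_pred0 n (Q : pred {ffun 'I_n -> T}) G M a : Q =1 xpred0 ->
  slice Q G M a = 0.
Proof. by move=> Q0; rewrite /slice big1// => z; rewrite Q0. Qed.

(** Split off the last letter (b, k, x). Its denominator N_n equals a on the whole slice, so a^(-k)
    factors out; the step x + 1 is taken from a, and from M too if b holds. The bound a <= A makes
    every step up to a available as a letter. *)
Lemma slice_snoc n (Q : pred {ffun 'I_n.+1 -> T}) (G : {ffun 'I_n.+1 -> T} -> F)
    (Q' : bool -> nat -> pred {ffun 'I_n -> T})
    (G' : bool -> nat -> {ffun 'I_n -> T} -> F) M a :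
  (a <= A)%N ->
  (forall z t, Q (snoc z t) = Q' (bit t) (expo t) z) ->
  (forall z t, G (snoc z t) =
    G' (bit t) (expo t) z * (total_step z + step t)%N%:R ^- expo t) ->
  slice Q G M a = \sum_(k < K) a%:R ^- k *
    (\sum_(x < a) slice (Q' false k) (G' false k) M (a - x.+1) +
     \sum_(x < a | (x < M)%N) slice (Q' true k) (G' true k) (M - x.+1) (a - x.+1)).
Proof.
move=> aA QE GE; rewrite /slice big_mkcond sum_snoc.
have peel (b : bool) (k : 'I_K) :
    \sum_(x < A) \sum_(z : {ffun 'I_n -> T})
      (if [&& Q (snoc z (b, k, x)), total_step (snoc z (b, k, x)) == a &
              marked_step (snoc z (b, k, x)) == M]
       then G (snoc z (b, k, x)) else 0) =
    a%:R ^- k * (\sum_(x < a | (b * x.+1 <= M)%N)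
                  slice (Q' b k) (G' b k) (M - b * x.+1) (a - x.+1)).
  rewrite (big_ord_widen_cond _ (fun x => (b * x.+1 <= M)%N)
    (fun x => slice (Q' b k) (G' b k) (M - b * x.+1) (a - x.+1)) aA).
  rewrite [X in _ * X]big_mkcond mulr_sumr; apply: eq_bigr => x _.
  case: ifPn => [/andP[bM xa]|]; last first.
    rewrite mulr0 => nMa; rewrite big1// => z _; rewrite ifF//.
    rewrite total_step_snoc marked_step_snoc /step /bit /=.
    by apply/negP => /and3P[_ /eqP h1 /eqP h2]; move: nMa; lia.
  rewrite -big_mkcond /= mulr_sumr.
  rewrite [LHS]big_mkcond [RHS]big_mkcond; apply: eq_bigr => z _.
  rewrite QE GE total_step_snoc marked_step_snoc /step /bit /expo /=.
  have -> : (total_step z + x.+1 == a)%N = (total_step z == a - x.+1)%N by lia.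
  have -> : (marked_step z + b * x.+1 == M)%N = (marked_step z == M - b * x.+1)%N.
    by lia.
  by case: ifPn => // /and3P[_ /eqP -> _]; rewrite subnK// mulrC.
rewrite sum_triple exchange_big; apply: eq_bigr => k _ /=.
rewrite big_bool /= !peel -mulrDr addrC; congr (_ * (_ + _)).
  by apply: eq_big => [x|x _]; rewrite mul0n// subn0.
by apply: eq_big => [x|x _]; rewrite mul1n.
Qed.

Definition Ysum n M a := slice (@all_ones n) (fun z => parity z * weight z) M a.

(** Here l is the excess of the weight over the length, and the minus sign turns (-1)^|J| into
    (-1)^(|J|-1). *)
Definition Rsum s n l M a :=
  slice (fun z : {ffun 'I_n -> T} => admissible z s && (total_expo z == n + l)%N)
        (fun z => - (parity z * weight z)) M a.

Lemma Ysum0 M a : Ysum 0 M a = ((M == 0) && (a == 0))%N%:R.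
Proof.
rewrite /Ysum /slice.
have z0 (z : {ffun 'I_0 -> T}) : [&& all_ones z, total_step z == a & marked_step z == M] =
    ((M == 0) && (a == 0))%N.
  have -> : all_ones z by apply/forallP => -[].
  by rewrite /total_step /marked_step !big_ord0 /= andbC !(eq_sym 0%N).
pose z1 : {ffun 'I_0 -> T} := ffun0 (card_ord 0).
have zE (z : {ffun 'I_0 -> T}) : (z == z1) by apply/eqP/ffunP => -[].
rewrite (eq_bigl _ _ z0); case: andP => _; last by rewrite big_pred0.
rewrite (big_pred1 z1) => [|z]; last by rewrite /= zE.
by rewrite /parity /weight !big_ord0 mulr1.
Qed.

Lemma slice_oppr n (Q : pred {ffun 'I_n -> T}) (G : {ffun 'I_n -> T} -> F) M a :
  slice Q (fun z => - G z) M a = - slice Q G M a.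
Proof. exact: sumrN. Qed.

Lemma YsumS n M a : (1 < K)%N -> (a <= A)%N ->
  Ysum n.+1 M a = a%:R^-1 * (\sum_(x < a) Ysum n M (a - x.+1) -
    \sum_(x < a | (x < M)%N) Ysum n (M - x.+1) (a - x.+1)).
Proof.
move=> K1 aA; rewrite /Ysum.
rewrite (slice_snoc M (Q' := fun _ k z => (k == 1%N) && all_ones z)
  (G' := fun b _ z => (-1) ^+ b * (parity z * weight z)) aA); first last.
- by move=> z t; rewrite parity_snoc weight_snoc !mulrA.
- by move=> z t; rewrite all_ones_snoc.
rewrite (bigD1 (Ordinal K1)) //= [X in _ + X]big1 ?addr0 => [|k k1].
  rewrite expr1 -sumrN; congr (_ * (_ + _)); apply: eq_bigr => x _.
    by rewrite /slice; apply: eq_bigr => z _; rewrite mul1r.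
  by rewrite -slice_oppr /slice; apply: eq_bigr => z _; rewrite mulN1r.
have k1F : (k == 1 :> nat) = false by apply: negbTE.
by rewrite !big1 ?addr0 ?mulr0// => x _; apply: slice_pred0 => z; rewrite k1F.
Qed.

(** Only the exponent 1 occurs, so [slice_snoc] reduces to the recurrence [YcoefS] divided by a. *)
Lemma YsumE n M a : (1 < K)%N -> (a <= A)%N -> Ysum n M a = Ycoef F n M a.
Proof.
move=> K1; elim: n M a => [|n IHn] M a aA; first by rewrite Ysum0 Ycoef0.
rewrite YsumS//.
have YE M' (x : 'I_a) : Ysum n M' (a - x.+1) = Ycoef F n M' (a - x.+1).
  by rewrite IHn// (leq_trans (leq_subr _ _)).
under eq_bigr do rewrite YE; under [X in _ - X]eq_bigr do rewrite YE.
rewrite -YcoefS; have [->|a0] := posnP a; last by rewrite mulKf ?pnatr_eq0 -?lt0n.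
(* At a = 0 the inverse of a is 0 by convention; [Ycoef] vanishes as well, being for M = 0 a
   coefficient of positive degree of 1. *)
rewrite invr0 mul0r /Ycoef; case: ifP => //; rewrite leqn0 => /eqP ->.
by rewrite subnn !mchoose0 mulr1 coef1.
Qed.

(** A last letter in J forces all other exponents to be 1, hence its own to be l + 1, and [VcoefS]
    sums what is left. Otherwise the last exponent is i + s + 1 and the shorter word has excess l -
    s - i. *)
Lemma RsumS s n l M a : (l.+1 < K)%N -> (s <= l)%N -> (a <= A)%N ->
  Rsum s n.+1 l M a = a%:R ^- l.+1 * Vcoef F n.+1 M a +
    \sum_(i < l.+1 - s) a%:R ^- (i + s).+1 *
      \sum_(x < a) Rsum 0 n (l - s - i) M (a - x.+1).
Proof.
move=> lK sl aA; have K1 : (1 < K)%N by exact: leq_ltn_trans lK.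
rewrite /Rsum.
rewrite (slice_snoc M (Q' := fun b k z => (s < k)%N &&
    (if b then all_ones z else admissible z 0) && (total_expo z + k == n.+1 + l)%N)
  (G' := fun b _ z => - ((-1) ^+ b * (parity z * weight z))) aA); first last.
- by move=> z t; rewrite parity_snoc weight_snoc !mulrA mulNr.
- by move=> z t; rewrite admissible_snoc total_expo_snoc.
under eq_bigr do rewrite mulrDr.
rewrite big_split [LHS]addrC /=; congr (_ + _).
  rewrite (bigD1 (Ordinal lK)) //= [X in _ + X]big1 ?addr0 => [|k kl]; last first.
    rewrite big1 ?mulr0// => x _; apply: slice_pred0 => z /=.
    case: (boolP (all_ones z)) => [/all_ones_total_expo ->|]; last by rewrite andbF.
    by apply/negP => /andP[_ /eqP h]; case/negP: kl; apply/eqP/ord_inj => /=; lia.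
  congr (_ * _); rewrite VcoefS; apply: eq_bigr => x xM.
  rewrite -YsumE//; last by rewrite (leq_trans (leq_subr _ _)).
  rewrite /Ysum /slice; apply: eq_big => [z|z _]; last by rewrite mulN1r opprK.
  rewrite ltnS sl /=; case: (boolP (all_ones z)) => //= /all_ones_total_expo ->.
  by rewrite addSnnS eqxx.
rewrite (bigID (fun k : 'I_K => (s < k <= l.+1)%N)) /= [X in _ + X]big1 ?addr0.
  pose H k := a%:R ^- k *
    \sum_(x < a) Rsum 0 n (l.+1 - k) M (a - x.+1) : F.
  transitivity (\sum_(k < K | (s < k <= l.+1)%N) H k).
    apply: eq_bigr => k /andP[sk kl]; congr (_ * _); apply: eq_bigr => x _.
    rewrite /Rsum /slice; apply: eq_big => [z|z _]; last by rewrite mul1r.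
    by rewrite sk /=; congr (_ && _ && _); apply/eqP/eqP; lia.
  rewrite -(big_mkord (fun k => (s < k <= l.+1)%N) H).
  rewrite (@big_cat_nat _ _ _ s.+1) //=; last by lia.
  rewrite [X in X + _]big_nat_cond [X in X + _]big_pred0 ?add0r; last by move=> k; lia.
  rewrite (@big_cat_nat _ _ _ l.+2) //=; last by lia.
  rewrite [X in _ + X]big_nat_cond [X in _ + X]big_pred0 ?addr0; last by move=> k; lia.
  rewrite -{1}[s.+1]add0n big_addn big_nat_cond.
  rewrite (eq_bigl (fun i => (0 <= i < l.+2 - s.+1)%N)); last by move=> i; lia.
  rewrite -big_nat big_mkord subSS; apply: eq_bigr => i _.
  by rewrite /H addnS; congr (_ * _); apply: eq_bigr => x _; congr Rsum; lia.
(* An exponent above l + 1 would leave the n earlier letters a weight below n. *)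
move=> k nkl; rewrite big1 ?mulr0// => x _; apply: slice_pred0 => z /=.
apply/negP => /andP[/andP[sk /admissible_total_expo nz] /eqP h].
by move: nkl; rewrite sk /=; lia.
Qed.

Lemma Rsum0 s l M a : Rsum s 0 l M a = 0.
Proof.
by apply: slice_pred0 => z; apply/negP => /andP[/and4P[/existsP[[]]]].
Qed.

(** Factorisation of u^(l+1) - v^(l+1) at u = 1/y and v = 1/x, where u - v = (x - y)/(xy). *)
Lemma geometric_telescope (x y : F) l : x != 0 -> y != 0 ->
  x ^- l.+1 + (x - y) * \sum_(i < l.+1) x ^- i.+1 * y ^- (l - i).+1 = y ^- l.+1.
Proof.
move=> x0 y0; elim: l => [|l IHl].
  by rewrite big_ord_recl big_ord0 /= !expr1; field; rewrite x0 y0.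
rewrite big_ord_recr /= subnn.
have -> : \sum_(i < l.+1) x ^- i.+1 * y ^- (l.+1 - i).+1 =
    y^-1 * \sum_(i < l.+1) x ^- i.+1 * y ^- (l - i).+1.
  rewrite mulr_sumr; apply: eq_bigr => i _.
  rewrite subSn; last by rewrite -ltnS.
  by rewrite [y ^+ _.+2]exprS invfM mulrCA.
rewrite [y ^+ l.+2]exprS [(y * _)^-1]invfM -IHl.
rewrite [x ^+ l.+2]exprS [(x * _)^-1]invfM expr1.
set S := \sum_(_ < _) _; set X := x ^- _.
by field; rewrite x0 y0.
Qed.

(** Induction on n through [RsumS]: the inner sums become sums of V_n, which [VcoefS_sum] evaluates
    as (a - M) V_{n+1}, and the remaining powers of a and M telescope. *)
Lemma Rsum_admissible0 n l M a : (l.+1 < K)%N -> (0 < M)%N -> (a <= A)%N ->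
  Rsum 0 n l M a = M%:R ^- l.+1 * Vcoef F n M a.
Proof.
move=> lK M0; elim: n l lK a => [|n IHn] l lK a aA.
  by rewrite Rsum0 Vcoef0 mulr0.
rewrite RsumS// !subn0.
have [aM|Ma] := ltnP a M.
  have V0 m b : (b < M)%N -> Vcoef F m M b = 0.
    by move=> bM; rewrite /Vcoef leqNgt bM.
  rewrite V0// !mulr0 add0r big1// => i _; rewrite big1 ?mulr0// => x _.
  have lt_il := ltn_ord i.
  by rewrite IHn ?V0 ?mulr0//; lia.
have a0 : (0 < a)%N by exact: leq_trans Ma.
rewrite -(@geometric_telescope a%:R M%:R l) ?pnatr_eq0 -?lt0n// mulrDl; congr (_ + _).
rewrite mulrAC VcoefS_sum mulr_sumr; apply: eq_bigr => i _.
rewrite addn0 [RHS]mulrC -mulrA; congr (_ * _).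
rewrite mulr_sumr; apply: eq_bigr => x _; rewrite IHn//.
  by have := ltn_ord i; lia.
by rewrite (leq_trans (leq_subr _ _)).
Qed.

(** Lowering the last exponent by 1 turns k_n >= 2 into k_n >= 1, lowers the weight by one and
    multiplies the product by N_n = a. *)
Lemma Rsum_admissible1 n l M a : (l.+2 < K)%N -> (0 < M)%N -> (a <= A)%N ->
  Rsum 1 n l.+1 M a = M%:R ^- l.+1 * (Vcoef F n M a / a%:R).
Proof.
move=> lK M0 aA; rewrite mulrA -Rsum_admissible0// 1?ltnW//.
case: n => [|n]; first by rewrite !Rsum0 mul0r.
rewrite !RsumS// 1?ltnW// mulrDl mulrAC [a%:R ^+ l.+2]exprSr.
rewrite invfM !subn0 subSS subn0; congr (_ + _).
rewrite mulr_suml; apply: eq_bigr => i _.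
rewrite addn0 addn1 mulrAC [a%:R ^+ i.+2]exprSr invfM.
by congr (_ * _); apply: eq_bigr => x _; congr Rsum; lia.
Qed.

End Words.

(** * The Beta integral, coefficient by coefficient in y *)

Section Limits.
Variable R : realType.
Implicit Types (M A n p j : nat).

Lemma coef_natl m (p : {poly R}) i : (m%:R * p)`_i = m%:R * p`_i.
Proof. by rewrite !mulr_natl coefMn. Qed.

(** By [mchoose_sum], the coefficient of y^(p+1) at j + 1 is the mean of the coefficients of y^p at
    0, ..., j, so Cesaro's theorem carries the induction. *)
Lemma mchooseX_cvg0 p : (fun j => (mchoose ('X : {poly R}) j)`_p) @ \oo --> (0 : R).
Proof.
elim: p => [|p IHp].
  by apply: cvg_near_cst; exists 1%N => // -[|j] // _; rewrite mchooseX0.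
have E j : (mchoose ('X : {poly R}) j.+1)`_p.+1 =
    arithmetic_mean (fun j => (mchoose ('X : {poly R}) j)`_p) j.
  rewrite /arithmetic_mean /= seriesEord /= -coef_sum -[X in _ = _ * X]coefXS -mchoose_sum.
  by rewrite coef_natl mulKf// pnatr_eq0.
rewrite -(cvg_shiftS (fun j => (mchoose ('X : {poly R}) j)`_p.+1)).
under eq_fun do rewrite E.
exact: cesaro.
Qed.

Definition poly_cvg (u : nat -> {poly R}) (l : {poly R}) : Prop :=
  forall p, (fun A => (u A)`_p) @ \oo --> l`_p.

Lemma poly_cvgMl q u l : poly_cvg u l -> poly_cvg (fun A => q * u A) (q * l).
Proof.
move=> ul p; under eq_fun do rewrite coefM; rewrite coefM.
by apply: cvg_big => [|i _]; [exact: add_continuous | apply: cvgMl_tmp; exact: ul].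
Qed.

Lemma poly_cvgB u v l m :
  poly_cvg u l -> poly_cvg v m -> poly_cvg (fun A => u A - v A) (l - m).
Proof.
by move=> ul vm p; under eq_fun do rewrite coefB; rewrite coefB; exact: cvgB.
Qed.

(** Truncation of the Beta integral of u^(M-1) (1 - u)^(-y) over [0, 1], with (1 - u)^(-y) expanded
    in powers of u. *)
Definition beta_sum M A : {poly R} :=
  \sum_(j < A) ((M + j)%N%:R^-1)%:P * mchoose 'X j.

Lemma polyCVn M : (0 < M)%N -> (M%:R^-1)%:P * M%:R = 1 :> {poly R}.
Proof.
by move=> M0; rewrite -polyC_natr -polyCM mulVf// pnatr_eq0 -lt0n.
Qed.

Lemma beta_sum1 A : (1 - 'X) * beta_sum 1 A = 1 - mchoose 'X A.
Proof.
elim: A => [|A IHA]; first by rewrite /beta_sum big_ord0 mulr0 mchoose0 subrr.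
rewrite /beta_sum big_ord_recr /= mulrDr -/(beta_sum 1 A) IHA add1n.
have h := polyCVn (ltn0Sn A); set w := (_^-1)%:P in h *.
have -> : mchoose 'X A.+1 = w * (mchoose 'X A * ('X + A%:R)) :> {poly R}.
  by rewrite -mchooseS mulrA h mul1r.
transitivity (1 - mchoose 'X A + (w * A.+1%:R) * mchoose 'X A -
              w * (mchoose 'X A * ('X + A%:R))); last by rewrite h; ring.
ring.
Qed.

(** The functional equation (M + 1 - y) B(M + 1, 1 - y) = M B(M, 1 - y) of the Beta function, with
    the boundary term left by truncation. *)
Lemma beta_sumS M A : (0 < M)%N ->
  (M.+1%:R - 'X) * beta_sum M.+1 A =
  M%:R * beta_sum M A - (A%:R / (M + A)%N%:R)%:P * mchoose 'X A.
Proof.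
move=> M0; elim: A => [|A IHA].
  by rewrite /beta_sum !big_ord0 mul0r polyC0 mul0r !mulr0 subr0.
rewrite /beta_sum !big_ord_recr /= !mulrDr -/(beta_sum M.+1 A) -/(beta_sum M A) IHA.
rewrite addSnnS !polyCM !polyC_natr.
have h := @polyCVn (M + A.+1) ltac:(lia); set w := (_^-1)%:P in h *.
have h0 := @polyCVn (M + A) ltac:(lia); set w0 := (_^-1)%:P in h0 *.
rewrite [A.+1%:R * w]mulrC -[w * _ * _]mulrA mchooseS.
apply/eqP; rewrite -subr_eq0; apply/eqP.
transitivity (mchoose 'X A * (w * (M + A.+1)%N%:R - w0 * (M + A)%N%:R)); last first.
  by rewrite h h0 subrr mulr0.
ring.
Qed.

(** The sum of (-y)_i / i! over i < M is (1 - y)_(M-1) / (M - 1)!, so this expresses B(M, 1 - y) =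
    (M - 1)! / (1 - y)_M. Induction on M by [beta_sumS], whose boundary term tends to 0. *)
Lemma beta_cvg M : (0 < M)%N ->
  poly_cvg (fun A => (M%:R - 'X) *
                ((\sum_(i < M) mchoose (- 'X) i) * beta_sum M A)) 1.
Proof.
elim: M => // -[_ _|M IHM _].
  rewrite big_ord_recl big_ord0 mchoose0 addr0 => p.
  under eq_fun do rewrite mul1r beta_sum1 coefB.
  have := cvgB (cvg_cst (1 : {poly R})`_p) (@mchooseX_cvg0 p); rewrite subr0; exact.
set e := \sum_(_ < M.+1) _ in IHM.
have eE : \sum_(i < M.+2) mchoose (- 'X : {poly R}) i = e + mchoose (- 'X) M.+1.
  by rewrite big_ord_recr.
have eM : M.+1%:R * (e + mchoose (- 'X) M.+1) = e * (M.+1%:R - 'X).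
  by rewrite mulrDr mchoose_sum -/e; ring.
have null : poly_cvg (fun A => (A%:R / (M.+1 + A)%N%:R)%:P * mchoose 'X A) 0.
  move=> p; rewrite coef0; apply/cvgr0Pnorm_lt => eps eps0.
  have /cvgr0Pnorm_lt /(_ _ eps0) := @mchooseX_cvg0 p.
  apply: filterS => A; apply: le_lt_trans.
  rewrite coefCM normrM ler_piMl// normrM normfV !normr_nat.
  by rewrite ler_pdivrMr ?ltr0n// mul1r ler_nat leq_addl.
have := poly_cvgB (IHM isT) (@poly_cvgMl (e + mchoose (- 'X) M.+1) _ _ null).
rewrite mulr0 subr0; congr poly_cvg.
apply/funext => A; rewrite eE [RHS]mulrCA beta_sumS// mulrBr; congr (_ - _).
by rewrite [RHS]mulrCA [RHS]mulrA eM; ring.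
Qed.

(** Division of [beta_cvg] by M - y: the limits c_n of the coefficients satisfy M c_0 = 1 and M
    c_{n+1} - c_n = 0. *)
Lemma beta_coef_cvg M n : (0 < M)%N ->
  (fun A => ((\sum_(i < M) mchoose (- 'X) i) * beta_sum M A)`_n) @ \oo -->
  (M%:R ^- n.+1 : R).
Proof.
move=> M0; set e := \sum_(_ < _) _.
have MR0 : M%:R != 0 :> R by rewrite pnatr_eq0 -lt0n.
elim: n => [|n IHn].
  have := @beta_cvg _ M0 0%N; rewrite -/e coef1 eqxx => /(@cvgMl_tmp _ _ _ _ _ M%:R^-1).
  rewrite mulr1 expr1; under eq_fun do
    rewrite mulrBl coefB coefXM subr0 coef_natl mulKf//.
  exact.
have := @beta_cvg _ M0 n.+1; rewrite -/e coef1 /= => h.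
have := @cvgMl_tmp _ _ _ _ _ M%:R^-1 _ (cvgD h IHn).
rewrite add0r -invfM -exprS; under eq_fun do
  rewrite fctE mulrBl coefB coefXS subrK coef_natl mulKf//.
exact.
Qed.

Lemma Vcoef_cvg M n : (0 < M)%N ->
  (fun A => \sum_(a < A) Vcoef R n.+1 M a / a%:R) @ \oo --> (M%:R ^- n.+1 : R).
Proof.
(* [Vcoef] vanishes for a < M; writing a = M + j turns 1/a into the weight 1/(M + j) of
   [beta_sum]. *)
move=> M0; rewrite -(cvg_shiftn M).
under eq_fun => A.
  rewrite -(big_mkord xpredT (fun a => Vcoef R n.+1 M a / a%:R)).
  rewrite (@big_cat_nat _ _ _ M) ?leq_addl//= big_nat_cond big1 ?add0r; last first.
    by move=> a /andP[/andP[_ aM] _]; rewrite /Vcoef leqNgt aM mul0r.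
  rewrite -{1}[M]add0n big_addn addnK big_mkord.
  over.
rewrite (_ : (fun _ => _) = (fun A =>
   ((\sum_(i < M) mchoose (- 'X) i) * beta_sum M A)`_n)).
  exact: beta_coef_cvg.
apply/funext => A; rewrite mulr_sumr coef_sum; apply: eq_bigr => j _.
rewrite /Vcoef leq_addl addnK -mulrA coefXS mulrCA coefCM mulrC.
by rewrite addnC.
Qed.

End Limits.

(** * Unordered sums and iterated limits *)

Section Nets.
Variables (R : realType) (I : choiceType).
Local Open Scope complex_scope.
Import ComplexField summability.
#[local] Existing Instance totally_filter.

Lemma partial_sumE (V : zmodType) (g : I -> V) (X : {fset I}) :
  partial_sum g X = \sum_(i <- X) g i.
Proof. by rewrite /partial_sum big_seq_fsetE. Qed.

(** The net is increasing and bounded, so it converges to its supremum. *)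
Lemma nonneg_partial_sum_cvg (g : I -> R) B :
  (forall i, 0 <= g i) -> (forall X, partial_sum g X <= B) ->
  cvg (partial_sum g @ totally).
Proof.
move=> g0 gB; set E := range (partial_sum g).
have supE : has_sup E.
  split; first by exists (partial_sum g fset0); exists fset0.
  by exists B => _ [X _ <-].
apply/cvg_ex; exists (sup E); apply/cvgrPdist_lt => e e0.
have [_ [X _ <-] ltX] := sup_adherent e0 supE.
exists X => //= Y /= XY.
have leXY : partial_sum g X <= partial_sum g Y.
  rewrite !partial_sumE (big_fsetID _ (mem X) Y) /=.
  rewrite (_ : [fset x in Y | x \in X]%fset = X); last first.
    by apply/fsetP => i; rewrite !inE /= andbC; case: (boolP (i \in X)) => //= /(fsubsetP XY).
  by rewrite lerDl sumr_ge0.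
have leYE : partial_sum g Y <= sup E by apply: ub_le_sup; [exact: supE.2 | exists Y].
by rewrite ger0_norm ?subr_ge0//; lra.
Qed.

(* g = (h + g) - h is a difference of two nonnegative bounded families. *)
Lemma dominated_partial_sum_cvg (g h : I -> R) B :
  (forall i, `|g i| <= h i) -> (forall X, partial_sum h X <= B) ->
  cvg (partial_sum g @ totally).
Proof.
move=> gh hB; have h0 i : 0 <= h i by rewrite (le_trans _ (gh i)).
have hg X : partial_sum (fun i => h i + g i) X <= B + B.
  rewrite !partial_sumE big_split /= -!partial_sumE lerD// (le_trans _ (hB X))//.
  rewrite !partial_sumE ler_sum// => i _.
  exact: le_trans (ler_norm _) (gh i).
have hg0 i : 0 <= h i + g i by have := gh i; rewrite ler_norml; lra.
have -> : partial_sum g = fun X => partial_sum (fun i => h i + g i) X - partial_sum h X.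
  by apply/funext => X; rewrite !partial_sumE -sumrB; apply: eq_bigr => i _; rewrite addrC addKr.
apply: is_cvgB; first exact: nonneg_partial_sum_cvg hg0 hg.
exact: nonneg_partial_sum_cvg h0 hB.
Qed.

Lemma real_complex_cvg (T : Type) (D : set_system T) (u : T -> R) (l : R) :
  Filter D -> u @ D --> l -> (fun x => (u x)%:C : R[i]^o) @ D --> (l%:C : R[i]^o).
Proof.
move=> FD /cvgrPdist_lt ul; apply/cvgrPdist_lt => eps eps0.
have epsE : eps = (complex.Re eps)%:C by rewrite RRe_real// gtr0_real.
have e0 : 0 < complex.Re eps by rewrite -ltcR -epsE.
have := ul _ e0; apply: filterS => x; rewrite epsE -rmorphB.
by rewrite normc_def /= expr0n addr0 sqrtr_sqr ltcR.
Qed.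

Lemma normr_Re_normc (z : R[i]) : `|complex.Re z| <= Normc.normc z.
Proof. by rewrite -lecR; exact: normc_ge_Re. Qed.

Lemma normr_Im_normc (z : R[i]) : `|complex.Im z| <= Normc.normc z.
Proof.
case: z => x y /=; rewrite -[X in X <= _]ger0_norm// -sqrtr_sqr real_normK ?num_real//.
by rewrite ler_wsqrtr// lerDr sqr_ge0.
Qed.

(** [summability.sum] is a limit operator that has a value even without convergence. Convergence is
    obtained for the real and imaginary parts separately, both dominated by the norm. *)
Lemma summable_sum_cvg (g : I -> R[i]^o) :
  esum.summable [set: I] (fun i => (Normc.normc (g i))%:E) ->
  partial_sum g @ totally --> summability.sum g.
Proof.
move=> gS; pose h i := Normc.normc (g i).
have h0 i : 0 <= h i by rewrite (le_trans _ (normr_Re_normc _)).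
have hB X : partial_sum h X <= fine (\esum_(i in [set: I]) (h i)%:E)%E.
  rewrite -lee_fin fineK; last first.
    rewrite -(@eq_esum _ _ _ (fun i => `|(h i)%:E|%E)) -?summableE// => i _.
    by rewrite gee0_abs// lee_fin.
  apply: esum_ge; exists [set` X]; first by split => //; exact: finite_fset.
  rewrite fsbig_finite ?set_fsetK; last exact: finite_fset.
  by rewrite partial_sumE sumEFin.
have /cvg_ex[x gx] : cvg (partial_sum (fun i => complex.Re (g i)) @ totally).
  by apply: (dominated_partial_sum_cvg (h := h)) hB => i; exact: normr_Re_normc.
have /cvg_ex[y gy] : cvg (partial_sum (fun i => complex.Im (g i)) @ totally).
  by apply: (dominated_partial_sum_cvg (h := h)) hB => i; exact: normr_Im_normc.
suff gz : partial_sum g @ totally --> (x%:C + 'i%C * y%:C : R[i]^o).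
  by rewrite /summability.sum (cvg_lim _ gz).
have -> : partial_sum g = fun X => (partial_sum (fun i => complex.Re (g i)) X)%:C +
    'i%C * (partial_sum (fun i => complex.Im (g i)) X)%:C.
  apply/funext => X; rewrite !partial_sumE !rmorph_sum mulr_sumr -big_split /=.
  by apply: eq_bigr => i _; rewrite -complexE.
apply: cvgD; first exact: real_complex_cvg gx.
apply: cvgMl_tmp; exact: real_complex_cvg gy.
Qed.

(** A fixed finite set lies in X t once each of its elements does, which is a finite intersection of
    members of D. *)
Lemma cvg_totally (T : Type) (D : set_system T) (X : T -> {fset I}) :
  Filter D -> (forall i, \forall t \near D, i \in X t) -> X @ D --> totally.
Proof.
move=> FD iX S [Y _ YS].
have : D (\bigcap_(i in [set` Y]) [set t | i \in X t]).
  by apply: filter_bigI => i _; exact: iX.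
rewrite -[nbhs _ _]/(D (X @^-1` S)); apply: filterS => t Yt.
by apply: YS; apply/fsubsetP => i iY; exact: Yt.
Qed.

End Nets.

(** For each late n, a single m that is late both for the double limit and for the inner limit at n
    compares v n with l. *)
Lemma cvg_iterated (K : numFieldType) (V : normedModType K) (u : nat * nat -> V)
    (v : nat -> V) (l : V) :
  u @ (\oo, \oo) --> l -> (forall n, (fun m => u (n, m)) @ \oo --> v n) ->
  v @ \oo --> l.
Proof.
move=> /cvgrPdist_lt ul uv; apply/cvgrPdist_lt => e e0.
have e2 : 0 < e / 2 by rewrite divr_gt0.
have [[P Q] /= [nP nQ] PQ] := ul _ e2.
apply: filterS nP => n Pn.
have /cvgrPdist_lt /(_ _ e2) vn := uv n.
have [m [Qm]] := filter_ex (filterI nQ vn).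
rewrite distrC => um; rewrite (splitr e) -(subrKA (u (n, m)) l).
rewrite (le_lt_trans (ler_normD _ _))// ltrD//.
exact: (PQ (n, m)).
Qed.

(** * Truncated series as sums over words, and their limits *)

Section Bridge.
Variables (R : realType) (n l : nat) (f : nat -> R[i]).
Local Notation k := (n + l.+1)%N.
Implicit Types (J : {set 'I_n}) (kk : {ffun 'I_n -> 'I_k.+1}).
Local Open Scope complex_scope.

Section Word.
Variable A : nat.
Notation T := (bool * 'I_k.+1 * 'I_A)%type.
Implicit Types (m : {ffun 'I_n -> 'I_A}).

Definition word J kk m : {ffun 'I_n -> T} := [ffun i => (i \in J, kk i, m i)].

Definition nat_steps m : {ffun 'I_n -> nat} := [ffun i => nat_of_ord (m i)].

Lemma sum_word (V : nmodType) (G : {ffun 'I_n -> T} -> V) :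
  \sum_z G z = \sum_(J : {set 'I_n}) \sum_kk \sum_m G (word J kk m).
Proof.
rewrite !pair_bigA /=.
apply: (reindex (fun p : {set 'I_n} * {ffun 'I_n -> 'I_k.+1} *
  {ffun 'I_n -> 'I_A} => word p.1.1 p.1.2 p.2)).
apply: onW_bij; exists (fun z : {ffun 'I_n -> T} =>
  ([set i | (z i).1.1]%SET, [ffun i => (z i).1.2], [ffun i => (z i).2])).
  move=> [[J kk] m] /=; congr (_, _, _).
  - by apply/setP => i; rewrite inE ffunE.
  - by apply/ffunP => i; rewrite !ffunE.
  - by apply/ffunP => i; rewrite !ffunE.
move=> z; apply/ffunP => i; rewrite !ffunE /= inE.
by case: (z i) => -[].
Qed.

(** Brings the range i < max J of [Iset] into the form used by [admissible]; i counts from 0 and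
    [maxidx] from 1. *)
Lemma lt_maxidx J (i : nat) : (i.+1 < maxidx J)%N = [exists j in J, (i < j)%N].
Proof.
rewrite ltnNge; apply/negP/existsP => [h|[j /andP[jJ ij]]].
  apply/existsP; apply: contra_notT h; rewrite negb_exists => /forallP h.
  apply/bigmax_leqP => j jJ; have := h j; rewrite jJ /= -leqNgt; lia.
by move=> /bigmax_leqP /(_ _ jJ); lia.
Qed.

Lemma admissible_word J kk m :
  admissible (word J kk m) 1 && (total_expo (word J kk m) == k) =
  (J != finset.set0) && (kk \in Iset n k (maxidx J)).
Proof.
have expoE i : expo (word J kk m i) = kk i by rewrite /expo ffunE.
have bitE i : bit (word J kk m i) = (i \in J) by rewrite /bit ffunE.
rewrite inE /admissible -!andbA [[&& [forall _, _ ==> _] & _]]andbC.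
have -> : [exists i, bit (word J kk m i)] = (J != finset.set0).
  by apply/existsP/set0Pn => -[i iJ]; exists i; rewrite bitE in iJ *.
have -> : [forall i, (0 < expo (word J kk m i))%N] = [forall i, (0 < kk i)%N].
  by apply: eq_forallb => i; rewrite expoE.
have -> : [forall i : 'I_n, (i.+1 == n) ==> (1 < expo (word J kk m i))%N] =
          [forall i : 'I_n, (i.+1 == n) ==> (1 < kk i)%N].
  by apply: eq_forallb => i; rewrite expoE.
have -> : [forall i : 'I_n, [exists j : 'I_n, (i < j)%N && bit (word J kk m j)] ==>
            (expo (word J kk m i) == 1%N)] =
          [forall i : 'I_n, (i.+1 < maxidx J)%N ==> (kk i == 1%N :> nat)].
  apply: eq_forallb => i; rewrite expoE lt_maxidx; congr (_ ==> _).
  by apply: eq_existsb => j; rewrite bitE andbC.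
have -> : total_expo (word J kk m) = (\sum_(i < n) kk i)%N.
  by apply: eq_bigr => i _; rewrite expoE.
by rewrite -!andbA; do ?bool_congr.
Qed.

Lemma total_step_word J kk m : total_step (word J kk m) = (\sum_(i < n) (m i).+1)%N.
Proof. by apply: eq_bigr => i _; rewrite /step ffunE. Qed.

Lemma marked_step_word J kk m :
  marked_step (word J kk m) = (\sum_(i in J) (m i).+1)%N.
Proof. by apply: eq_big => i; rewrite /bit /step ffunE. Qed.

Lemma parity_word J kk m : J != finset.set0 ->
  parity R (word J kk m) = - (-1) ^+ (#|J| - 1).
Proof.
rewrite -card_gt0 => J0; have bitE : (\sum_(i < n) bit (word J kk m i))%N = #|J|.
  rewrite -sum1_card [RHS]big_mkcond; apply: eq_bigr => i _.
  by rewrite /bit ffunE /=; case: (i \in J).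
by rewrite /parity bitE -{1}(prednK J0) exprS mulN1r subn1.
Qed.

Lemma Lterm_word J kk m : Lterm (fun i => kk i) f J (nat_steps m) =
  f (marked_step (word J kk m)) * (weight R (word J kk m))%:C.
Proof.
rewrite /Lterm /weight marked_step_word rmorph_prod -prodfV; congr (f _ * _).
  by apply: eq_bigr => i _; rewrite ffunE.
apply: eq_bigr => i _; rewrite fmorphV rmorphXn rmorph_nat /expo /partial_step.
rewrite ffunE; congr (_%:R ^- _).
by apply: eq_bigr => j _; rewrite /step !ffunE.
Qed.

(** The cutoff A on N_n and the cutoff c on the sum over J stay separate because A tends to infinity
    first. Steps from 'I_A lose nothing, as each m_i is at most N_n < A. *)
Definition box J c : {fset {ffun 'I_n -> nat}} :=
  [fset nat_steps m | m in [pred m : {ffun 'I_n -> 'I_A} |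
    (\sum_(i < n) (m i).+1 < A)%N && (\sum_(i in J) (m i).+1 <= c)%N]]%fset.

Lemma nat_steps_inj : injective nat_steps.
Proof.
move=> m m' /ffunP mm'; apply/ffunP => i; apply/val_inj.
by have := mm' i; rewrite !ffunE.
Qed.

Lemma partial_sum_box (V : zmodType) (g : {ffun 'I_n -> nat} -> V) J c :
  summability.partial_sum g (box J c) =
  \sum_(m : {ffun 'I_n -> 'I_A} |
    (\sum_(i < n) (m i).+1 < A)%N && (\sum_(i in J) (m i).+1 <= c)%N)
    g (nat_steps m).
Proof.
rewrite partial_sumE big_imfset /=; last by move=> x y _ _; exact: nat_steps_inj.
by rewrite big_enum.
Qed.

Lemma mem_box J c (m : {ffun 'I_n -> nat}) :
  (\sum_(i < n) (m i).+1 < A)%N -> (\sum_(i in J) (m i).+1 <= c)%N ->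
  m \in box J c.
Proof.
move=> mA mc; have mi i : (m i < A)%N.
  apply: leq_ltn_trans mA; rewrite (bigD1 i)//=; lia.
have mE : m = nat_steps [ffun i => Ordinal (mi i)].
  by apply/ffunP => i; rewrite !ffunE.
apply/imfsetP; exists [ffun i => Ordinal (mi i)] => //=.
apply/andP; split.
  by rewrite (eq_bigr (fun i => (m i).+1))// => i _; rewrite ffunE.
by rewrite (eq_bigr (fun i => (m i).+1))// => i _; rewrite ffunE.
Qed.

End Word.

Lemma box_cvg J : (fun cA => box cA.2 J cA.1) @ (\oo, \oo) --> summability.totally.
Proof.
apply: cvg_totally => m; near=> cA; apply: mem_box.
  near: cA; exists ([set: nat], [set A | (\sum_(i < n) (m i).+1 < A)%N]).
    by split => /=; [exact: filterT | exact: nbhs_infty_gt].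
  by move=> [c A] [].
near: cA; exists ([set c | (\sum_(i in J) (m i).+1 <= c)%N], [set: nat]).
  by split => /=; [exact: nbhs_infty_ge | exact: filterT].
by move=> [c A] [].
Unshelve. all: by end_near. Qed.

(** The value of f depends only on the sum over J, so words are grouped by that sum and by N_n = a,
    and [Rsum_admissible1] evaluates each group. *)
Lemma sum_box (c A : nat) : (0 < n)%N ->
  \sum_(J : {set 'I_n} | J != finset.set0)
     \sum_(kk in Iset n k (maxidx J))
       (-1) ^+ (#|J| - 1) *
       summability.partial_sum (Lterm (fun i => kk i) f J) (box A J c) =
  \sum_(M < c) f M.+1 *
    (M.+1%:R ^- l.+1 * \sum_(a < A) Vcoef R n M.+1 a / a%:R)%:C.
Proof.
move=> n0.
pose T := (bool * 'I_k.+1 * 'I_A)%type.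
pose Q (z : {ffun 'I_n -> T}) := admissible z 1 && (total_expo z == k).
pose G (z : {ffun 'I_n -> T}) := - (parity R z * weight R z).
transitivity (\sum_(z : {ffun 'I_n -> T})
    if [&& Q z, (total_step z < A)%N & (marked_step z <= c)%N]
    then f (marked_step z) * (G z)%:C else 0).
  rewrite sum_word big_mkcond /=; apply: eq_bigr => J _.
  case: ifPn => [J0|J0]; last first.
    rewrite big1// => kk _; rewrite big1// => m _.
    by rewrite ifF// /Q admissible_word (negbTE J0).
  rewrite big_mkcond; apply: eq_bigr => kk _ /=.
  case: ifPn => [kkI|kkI]; last first.
    by rewrite big1// => m _; rewrite ifF// /Q admissible_word (negbTE kkI) andbF.
  rewrite partial_sum_box mulr_sumr big_mkcond; apply: eq_bigr => m _ /=.
  rewrite /Q admissible_word J0 kkI total_step_word marked_step_word /=.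
  case: ifP => // _; rewrite Lterm_word marked_step_word /G parity_word// mulNr opprK.
  by rewrite rmorphM rmorphXn rmorphN1 mulrCA.
transitivity (\sum_(M < c) \sum_(a < A) \sum_(z : {ffun 'I_n -> T})
    if [&& Q z, total_step z == a & marked_step z == M.+1]
    then f M.+1 * (G z)%:C else 0).
  under [RHS]eq_bigr do rewrite exchange_big.
  rewrite exchange_big; apply: eq_bigr => z _ /=.
  have [/andP[/and4P[/existsP[i bi] _ _ _] _]|nQ] := boolP (Q z); last first.
    by rewrite big1// => M _; rewrite big1.
  (* J is nonempty, so the marked sum is M + 1 for exactly one M >= 0. *)
  have z0 : (0 < marked_step z)%N.
    by rewrite /marked_step (bigD1 i).
  rewrite /=; case: ifPn => [/andP[tA mc]|ncA]; last first.
    rewrite big1// => M _; rewrite big1// => a _; rewrite ifF//=.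
    apply/negP => /andP[/eqP ta /eqP mM]; case/negP: ncA.
    by rewrite ta mM !ltn_ord.
  have Mc : ((marked_step z).-1 < c)%N by rewrite prednK.
  rewrite (bigD1 (Ordinal Mc))//= [X in _ + X]big1 => [|M nM]; last first.
    rewrite big1// => a _; rewrite ifF//; apply/negP => /andP[_ /eqP mM].
    by case/negP: nM; apply/eqP/ord_inj; rewrite /= mM.
  rewrite (bigD1 (Ordinal tA))//= big1 => [|a na]; last first.
    rewrite ifF//; apply/negP => /andP[/eqP ta _].
    by case/negP: na; apply/eqP/ord_inj; rewrite /= ta.
  by rewrite prednK// !eqxx !addr0.
apply: eq_bigr => M _; rewrite mulr_sumr rmorph_sum mulr_sumr.
apply: eq_bigr => a _; rewrite -(@Rsum_admissible1 R k.+1 A)//; last 2 first.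
(* The bound l + 2 < k + 1 = n + l + 2 uses n > 0. *)
- by rewrite ltnS -addn1 addnS addn0; lia.
- exact: ltnW.
by rewrite /Rsum /slice rmorph_sum mulr_sumr [RHS]big_mkcond.
Qed.

Lemma iterated_limit (c : nat) : (0 < n)%N ->
  (fun A => \sum_(M < c) f M.+1 *
    (M.+1%:R ^- l.+1 * \sum_(a < A) Vcoef R n M.+1 a / a%:R)%:C : R[i]^o) @ \oo -->
  (\sum_(M < c) f M.+1 / M.+1%:R ^+ k : R[i]^o).
Proof.
move=> n0; apply: cvg_big => [|M _]; first exact: add_continuous.
apply: cvgMl_tmp.
(* The exponent l + 1 = k - n comes from the closed form, the exponent n from the limit of the sum
   over a. *)
have -> : (M.+1%:R ^+ k)^-1 = (M.+1%:R ^- l.+1 * M.+1%:R ^- n : R)%:C.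
  by rewrite -invfM -exprD addnC fmorphV rmorphXn rmorph_nat.
apply: real_complex_cvg; apply: cvgMl_tmp.
by have := @Vcoef_cvg R M.+1 n.-1 isT; rewrite prednK.
Qed.

End Bridge.

Theorem theorem1p1 (R : realType) (n k : nat) (f : nat -> R[i]) :
  (0 < n)%N -> (n < k)%N ->
  (forall J : {set 'I_n}, J != finset.set0 ->
     forall kk : {ffun 'I_n -> 'I_k.+1}, kk \in Iset n k (maxidx J) ->
       L_abs_cvg (fun i => kk i) f J) ->
  (series (fun m : nat => f m.+1 / m.+1%:R ^+ k) : nat -> R[i]^o) @ \oo -->
  (\sum_(J : {set 'I_n} | J != finset.set0)
     \sum_(kk in Iset n k (maxidx J))
       (-1) ^+ (#|J| - 1) * L (fun i => kk i) f J : R[i]^o).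
Proof.
move=> n0 nk fL.
have [l kE] : exists l, k = (n + l.+1)%N by exists (k - n).-1; lia.
subst k.
(* The signed sum of the truncated series. Absolute convergence gives its double limit in (c, A); at
   fixed c its limit in A is the c-th partial sum of the series of f(m)/m^k. *)
pose Z (cA : nat * nat) : R[i]^o := \sum_(J : {set 'I_n} | J != finset.set0)
  \sum_(kk in Iset n (n + l.+1) (maxidx J)) (-1) ^+ (#|J| - 1) *
  summability.partial_sum (Lterm (fun i => kk i) f J) (box cA.2 J cA.1).
rewrite seriesEord; apply: (@cvg_iterated _ _ Z).
  apply: cvg_big => [|J J0]; first exact: add_continuous.
  apply: cvg_big => [|kk kkI]; first exact: add_continuous.
  apply: cvgMl_tmp; apply: cvg_comp (box_cvg J) _.
  exact: summable_sum_cvg (fL J J0 kk kkI).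
move=> c; rewrite (_ : (fun _ => _) = (fun A => \sum_(M < c) f M.+1 *
    ((M.+1%:R ^- l.+1 * \sum_(a < A) Vcoef R n M.+1 a / a%:R)%:C)%C : R[i]^o)).
  exact: iterated_limit.
by apply/funext => A; exact: sum_box.
Qed.
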